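(* (Strong Duality) Let $\bar z\in\Omega$ and $\bar w\in\Theta$ be feasible solutions of (CLP) and (CDP), respectively. Assume that $\beta$-A is satisfied at $\bar z$ for some $\beta>0$. Then $F(\bar z)=G(\bar w)$ if, and only if, $\bar z$ is an optimal solution of (CLP) and $\bar w$ is an optimal solution of (CDP).
   Context: Setting: $T>0$, and $A:[0,T]\to\mathbb{R}^{m\times n}$, $b:[0,T]\to\mathbb{R}^m$, $c:[0,T]\to\mathbb{R}^n$ have measurable, essentially bounded entries; thus there is $K>0$ with $\|A(t)\|,\|b(t)\|,\|c(t)\|\le K$ for a.e. $t$. Let $I=\{1,\dots,m\}$ and let $a_i(t)^\top$ be the $i$-th row of $A(t)$. Primal problem (CLP): minimize $F(z)=\int_0^T c(t)^\top z(t)\,dt$ over $\Omega=\{z\in L^\infty([0,T];\mathbb{R}^n): A(t)z(t)\le b(t)\text{ a.e. in }[0,T]\}$ (inequalities componentwise); $\bar z\in\Omega$ is optimal if $F(\bar z)\le F(z)$ for all $z\in\Omega$. Dual problem (CDP): maximize $G(w)=\int_0^T b(t)^\top w(t)\,dt$ over $\Theta=\{w\in L^\infty([0,T];\mathbb{R}^m): A(t)^\top w(t)=c(t),\ w(t)\le 0\text{ a.e. in }[0,T]\}$; $\bar w\in\Theta$ is optimal if $G(\bar w)\ge G(w)$ for all $w\in\Theta$. For $\mathcal I\subset I$, $A^{\mathcal I}(t)$ is the matrix obtained from $A(t)$ by keeping only the rows with index in $\mathcal I$, and $\mathrm{cone}(A^{\mathcal I}(t))$ is the convex cone generated by its rows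 (all nonnegative linear combinations; $\{0\}$ if $\mathcal I=\emptyset$). The determinant of the $0\times0$ matrix is $1$. Given $\bar z\in\Omega$ and $\beta>0$, $I_\beta(t)=\{i\in I: -\beta\le a_i(t)^\top\bar z(t)-b_i(t)\le 0\}$ and $I_0(t)=\{i\in I: a_i(t)^\top\bar z(t)-b_i(t)=0\}$. $\beta$-RC is satisfied at $\bar z\in\Omega$ if there exist index subsets $I_\sharp(t)\subset I_\beta(t)$ and a constant $\bar K>0$ such that, for a.e. $t\in[0,T]$, $\mathrm{cone}(A^{I_\sharp(t)}(t))=\mathrm{cone}(A^{I_\beta(t)}(t))$ and $\det\big(A^{I_\sharp(t)}(t)A^{I_\sharp(t)}(t)^\top\big)\ge\bar K$. $\beta$-FR is satisfied at $\bar z\in\Omega$ if there is a constant $\hat K>0$ such that $\det\big(A^{I_\beta(t)}(t)A^{I_\beta(t)}(t)^\top\big)\ge\hat K$ for a.e. $t\in[0,T]$. $\beta$-A is satisfied at $\bar z\in\Omega$ if either (i) $\beta$-RC is valid at $\bar z$ with $I_\sharp(t)\subseteq I_0(t)$ a.e. in $[0,T]$; or (ii) $\beta$-FR is valid at $\bar z$. *)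

(* Defs.v *)
From mathcomp Require Import all_boot all_order all_algebra.
From mathcomp Require Import all_classical all_reals all_analysis.

Set Implicit Arguments.
Unset Strict Implicit.
Unset Printing Implicit Defensive.

Import Order.TTheory GRing.Theory Num.Theory.
Import numFieldNormedType.Exports.

Local Open Scope classical_set_scope.
Local Open Scope ring_scope.

(* [completed_lebesgue_measure], rather than [lebesgue_measure], because the
   latter's sigma-algebra contains the Borel sets only: here measurable means
   Lebesgue measurable. *)
Notation leb := completed_lebesgue_measure.

Definition ae_itv (R : realType) (T : R) (P : R -> Prop) : Prop :=
  {ae leb, forall t, t \in `[0, T] -> P t}.

(* Functions on [0, T] are represented by total functions on R whose values
   outside [0, T] are irrelevant: [f \_ `[0, T]] is f extended by 0. *)
Definition Linfty (R : realType) (T : R) (f : R -> R) : Prop :=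
  f \_ `[0, T] \in Lfun leb +oo%E.

Definition Linfty_mx (R : realType) (T : R) (p q : nat)
    (M : R -> 'M[R]_(p, q)) : Prop :=
  forall i j, Linfty T (fun t => M t i j).

Definition Omega (R : realType) (m n : nat) (T : R)
    (A : R -> 'M[R]_(m, n)) (b : R -> 'cV[R]_m) : set (R -> 'cV[R]_n) :=
  [set z | Linfty_mx T z /\
           ae_itv T (fun t => forall i, (A t *m z t) i 0 <= b t i 0)].

Definition Theta (R : realType) (m n : nat) (T : R)
    (A : R -> 'M[R]_(m, n)) (c : R -> 'cV[R]_n) : set (R -> 'cV[R]_m) :=
  [set w | Linfty_mx T w /\
           ae_itv T (fun t => (A t)^T *m w t = c t /\
                              forall i, w t i 0 <= 0)].

Definition F (R : realType) (n : nat) (T : R) (c z : R -> 'cV[R]_n) : R :=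
  \int[leb]_(t in `[0, T]) ((c t)^T *m z t) 0 0.

Definition G (R : realType) (m : nat) (T : R) (b w : R -> 'cV[R]_m) : R :=
  \int[leb]_(t in `[0, T]) ((b t)^T *m w t) 0 0.

Definition CLP_optimal (R : realType) (m n : nat) (T : R)
    (A : R -> 'M[R]_(m, n)) (b : R -> 'cV[R]_m) (c z : R -> 'cV[R]_n) : Prop :=
  Omega T A b z /\ forall z', Omega T A b z' -> F T c z <= F T c z'.

Definition CDP_optimal (R : realType) (m n : nat) (T : R)
    (A : R -> 'M[R]_(m, n)) (b : R -> 'cV[R]_m) (c : R -> 'cV[R]_n)
    (w : R -> 'cV[R]_m) : Prop :=
  Theta T A c w /\ forall w', Theta T A c w' -> G T b w' <= G T b w.

Definition rows_in (R : realType) (m n : nat) (I : {set 'I_m})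
    (M : 'M[R]_(m, n)) : 'M[R]_(#|I|, n) :=
  rowsub enum_val M.

Definition cone (R : realType) (k n : nat) (M : 'M[R]_(k, n)) :
    set 'rV[R]_n :=
  [set v | exists2 l : 'rV[R]_k, (forall i, 0 <= l 0 i) & v = l *m M].

Definition gram_det (R : realType) (m n : nat) (I : {set 'I_m})
    (M : 'M[R]_(m, n)) : R :=
  \det (rows_in I M *m (rows_in I M)^T).

Definition I_beta (R : realType) (m n : nat)
    (A : R -> 'M[R]_(m, n)) (b : R -> 'cV[R]_m) (z : R -> 'cV[R]_n)
    (beta t : R) : {set 'I_m} :=
  [set i | - beta <= (A t *m z t) i 0 - b t i 0 <= 0].

Definition I_0 (R : realType) (m n : nat)
    (A : R -> 'M[R]_(m, n)) (b : R -> 'cV[R]_m) (z : R -> 'cV[R]_n)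
    (t : R) : {set 'I_m} :=
  [set i | (A t *m z t) i 0 - b t i 0 == 0].

Definition beta_RC_with (R : realType) (m n : nat) (T : R)
    (A : R -> 'M[R]_(m, n)) (b : R -> 'cV[R]_m) (z : R -> 'cV[R]_n)
    (beta : R) (I_sharp : R -> {set 'I_m}) : Prop :=
  (forall t, t \in `[0, T] -> I_sharp t \subset I_beta A b z beta t) /\
  exists2 K : R, 0 < K &
    ae_itv T (fun t =>
      cone (rows_in (I_sharp t) (A t)) =
        cone (rows_in (I_beta A b z beta t) (A t)) /\
      K <= gram_det (I_sharp t) (A t)).

Definition beta_FR (R : realType) (m n : nat) (T : R)
    (A : R -> 'M[R]_(m, n)) (b : R -> 'cV[R]_m) (z : R -> 'cV[R]_n)
    (beta : R) : Prop :=
  exists2 K : R, 0 < K &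
    ae_itv T (fun t => K <= gram_det (I_beta A b z beta t) (A t)).

Definition beta_A (R : realType) (m n : nat) (T : R)
    (A : R -> 'M[R]_(m, n)) (b : R -> 'cV[R]_m) (z : R -> 'cV[R]_n)
    (beta : R) : Prop :=
  (exists2 I_sharp : R -> {set 'I_m},
      beta_RC_with T A b z beta I_sharp &
      ae_itv T (fun t => I_sharp t \subset I_0 A b z t)) \/
  beta_FR T A b z beta.

(* Main.v *)
(** Weak duality gives one direction. For the other, let [z] be optimal and let
    [s := b - A z >= 0] be its slack. Under the regularity condition there is,
    at almost every [t], a set [J] of rows of [A] whose Gram matrix is uniformly
    invertible and which generates the cone of the [beta]-active rows; [J] can
    be chosen measurably among the finitely many index sets. Let [Y] be the
    least-squares solution of [A^T Y = c] supported on [J], let [p] be the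
    residual [c - A^T Y], and let [d] be the bounded direction
    with [(A d)_i = min (- Y_i) s_i] on [J] and component [- p] orthogonal to
    the rows in [J]. Then [z + eps d] is feasible for small [eps > 0], because
    the rows that are not [beta]-active have slack at least [beta], and

      [c^T d = sum_i Y_i * min (- Y_i) s_i - |p|^2 <= 0].

    Optimality of [z] forces [c^T d = 0] a.e., hence [p = 0], [Y <= 0] and
    [Y_i s_i = 0]: [Y] is dual feasible with the same value as [z], so the dual
    optimum equals [F z]. *)
Require Import Defs.
From mathcomp Require Import all_boot all_order all_algebra.
From mathcomp Require Import all_classical all_reals all_analysis.
From mathcomp Require Import measurable_realfun ess_sup_inf.

Set Implicit Arguments.
Unset Strict Implicit.
Unset Printing Implicit Defensive.

Import Order.TTheory GRing.Theory Num.Theory.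
Import numFieldNormedType.Exports.

Local Open Scope classical_set_scope.
Local Open Scope ring_scope.

(** * Essentially bounded measurable functions and matrices on a set [D] *)

Section EssBounded.
Context d (X : measurableType d) (R : realType).
Variables (mu : {measure set X -> \bar R}) (D : set X).

Definition ae_on (P : X -> Prop) := {ae mu, forall x, D x -> P x}.

(** An explicit a.e. bound in place of an essential supremum keeps closure under algebraic
    operations elementary; [LinftyE] makes the link with [Linfty]. *)
Definition ess_bounded (f : X -> R) :=
  measurable_fun D f /\ exists M, ae_on (fun x => `|f x| <= M).

Definition ess_bounded_mx p q (M : X -> 'M[R]_(p, q)) :=
  forall i j, ess_bounded (fun x => M x i j).

Lemma ae_onS (P Q : X -> Prop) :
  (forall x, D x -> P x -> Q x) -> ae_on P -> ae_on Q.
Proof. by rewrite /ae_on => PQ; apply: filterS => x Px Dx; exact: PQ (Px Dx). Qed.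

Lemma ae_on_and (P Q : X -> Prop) :
  ae_on P -> ae_on Q -> ae_on (fun x => P x /\ Q x).
Proof. by rewrite /ae_on; apply: filterS2 => x Px Qx Dx; split; [exact: Px | exact: Qx]. Qed.

Lemma ae_on_forall (I : finType) (P : I -> X -> Prop) :
  (forall i, ae_on (P i)) -> ae_on (fun x => forall i, P i x).
Proof.
move=> aeP.
suff: ae_on (fun x => forall i, i \in enum I -> P i x).
  by apply: ae_onS => x _ Px i; apply: Px; rewrite mem_enum.
elim: (enum I) => [|i s IH]; first by apply/nearW.
apply: (ae_onS _ (ae_on_and (aeP i) IH)) => x _ [Pi Ps] j.
by rewrite inE => /predU1P[->//|/Ps].
Qed.

Lemma ess_bounded_cst (r : R) : ess_bounded (fun=> r).
Proof. by split; [exact: measurable_cst | exists `|r|; apply/nearW]. Qed.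

Lemma ess_boundedD f g : ess_bounded f -> ess_bounded g ->
  ess_bounded (fun x => f x + g x).
Proof.
move=> [mf [M fM]] [mg [N gN]]; split; first exact: measurable_funD.
exists (M + N); apply: (ae_onS _ (ae_on_and fM gN)) => x _ [fxM gxN].
by rewrite (le_trans (ler_normD _ _))// lerD.
Qed.

Lemma ess_boundedM f g : ess_bounded f -> ess_bounded g ->
  ess_bounded (fun x => f x * g x).
Proof.
move=> [mf [M fM]] [mg [N gN]]; split; first exact: measurable_funM.
exists (M * N); apply: (ae_onS _ (ae_on_and fM gN)) => x _ [fxM gxN].
by rewrite normrM ler_pM.
Qed.

Lemma ess_boundedN f : ess_bounded f -> ess_bounded (fun x => - f x).
Proof.
move=> bf; rewrite (_ : (fun x => - f x) = (fun x => -1 * f x)).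
  exact/ess_boundedM/bf/ess_bounded_cst.
by apply/funext => x; rewrite mulN1r.
Qed.

Lemma ess_boundedB f g : ess_bounded f -> ess_bounded g ->
  ess_bounded (fun x => f x - g x).
Proof. by move=> bf bg; apply: ess_boundedD => //; exact: ess_boundedN. Qed.

Lemma ess_bounded_min f g : ess_bounded f -> ess_bounded g ->
  ess_bounded (fun x => Num.min (f x) (g x)).
Proof.
move=> [mf [M fM]] [mg [N gN]]; split; first exact: measurable_minr.
exists (Num.max M N); apply: (ae_onS _ (ae_on_and fM gN)) => x _ [fxM gxN].
by rewrite le_max; case: (leP (f x)); rewrite ?fxM ?gxN ?orbT.
Qed.

Lemma ess_bounded_sum (I : Type) (s : seq I) (P : pred I) (f : I -> X -> R) :
  (forall i, ess_bounded (f i)) ->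
  ess_bounded (fun x => \sum_(i <- s | P i) f i x).
Proof.
move=> bf; elim: s => [|i s IH].
  under eq_fun do rewrite big_nil; exact: ess_bounded_cst.
under eq_fun do rewrite big_cons; case: (P i) => //; exact: ess_boundedD.
Qed.

Lemma ess_bounded_prod (I : Type) (s : seq I) (P : pred I) (f : I -> X -> R) :
  (forall i, ess_bounded (f i)) ->
  ess_bounded (fun x => \prod_(i <- s | P i) f i x).
Proof.
move=> bf; elim: s => [|i s IH].
  under eq_fun do rewrite big_nil; exact: ess_bounded_cst.
under eq_fun do rewrite big_cons; case: (P i) => //; exact: ess_boundedM.
Qed.

(** The cap keeps the denominator at least [K], so [K^-1] is a bound at every point; measurability
    comes from the continuity of [y |-> (max y K)^-1]. *)
Lemma ess_bounded_inv_max f K : 0 < K -> ess_bounded f ->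
  ess_bounded (fun x => (Num.max (f x) K)^-1).
Proof.
move=> K0 [mf _].
have maxK0 (y : R) : 0 < Num.max y K by rewrite lt_max K0 orbT.
split; last first.
  exists K^-1; apply/nearW => x Dx.
  rewrite ger0_norm; last by rewrite invr_ge0 ltW.
  by rewrite lef_pV2 ?posrE// le_max lexx orbT.
apply: (@measurableT_comp _ _ _ _ _ _ (fun y : R => (Num.max y K)^-1) D f) => //.
apply: continuous_measurable_fun => y; apply: cvgV; first by rewrite gt_eqF.
by apply: (@continuous_max _ _ id (fun=> K)); [exact: cvg_id | exact: cvg_cst].
Qed.

Lemma ess_bounded_if (mD : measurable D) (p : X -> bool) f g :
  measurable_fun D p -> ess_bounded f -> ess_bounded g ->
  ess_bounded (fun x => if p x then f x else g x).
Proof.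
move=> mp [mf [M fM]] [mg [N gN]]; split.
  by apply: measurable_fun_if => //;
    apply: (measurable_funS mD) => //; exact: subIsetl.
exists (Num.max M N); apply: (ae_onS _ (ae_on_and fM gN)) => x _ [fxM gxN].
by rewrite le_max; case: ifP; rewrite ?fxM ?gxN ?orbT.
Qed.

Lemma measurable_bool_if (mD : measurable D) (p q r : X -> bool) :
  measurable_fun D p -> measurable_fun D q -> measurable_fun D r ->
  measurable_fun D (fun x => if p x then q x else r x).
Proof.
move=> mp mq mr; apply: measurable_fun_if => //;
  by apply: (measurable_funS mD) => //; exact: subIsetl.
Qed.

Lemma measurable_implyb (mD : measurable D) (p q : X -> bool) :
  measurable_fun D p -> measurable_fun D q ->
  measurable_fun D (fun x => p x ==> q x).
Proof.
by move=> mp mq; apply: measurable_bool_if => //; exact: measurable_cst.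
Qed.

Lemma measurable_forall (mD : measurable D) (I : finType) (p : I -> X -> bool) :
  (forall i, measurable_fun D (p i)) ->
  measurable_fun D (fun x => [forall i, p i x]).
Proof.
move=> mp.
rewrite (_ : (fun x => _) = (fun x => \big[andb/true]_i p i x)); last first.
  by apply/funext => x; rewrite big_andE.
elim: (index_enum I) => [|i s IH].
  by under eq_fun do rewrite big_nil; exact: measurable_cst.
under eq_fun do rewrite big_cons; exact: measurable_and.
Qed.

Lemma ess_bounded_mxD p q (M N : X -> 'M[R]_(p, q)) :
  ess_bounded_mx M -> ess_bounded_mx N -> ess_bounded_mx (fun x => M x + N x).
Proof.
by move=> bM bN i j; under eq_fun do rewrite mxE; exact: ess_boundedD.
Qed.

Lemma ess_bounded_mxB p q (M N : X -> 'M[R]_(p, q)) :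
  ess_bounded_mx M -> ess_bounded_mx N -> ess_bounded_mx (fun x => M x - N x).
Proof.
move=> bM bN i j; under eq_fun do rewrite mxE [X in _ + X]mxE.
exact: ess_boundedB.
Qed.

Lemma ess_bounded_mxZ p q f (M : X -> 'M[R]_(p, q)) :
  ess_bounded f -> ess_bounded_mx M -> ess_bounded_mx (fun x => f x *: M x).
Proof.
by move=> bf bM i j; under eq_fun do rewrite mxE; exact: ess_boundedM.
Qed.

Lemma ess_bounded_mx_cst p q (M : 'M[R]_(p, q)) : ess_bounded_mx (fun=> M).
Proof. by move=> i j; exact: ess_bounded_cst. Qed.

Lemma ess_bounded_trmx p q (M : X -> 'M[R]_(p, q)) :
  ess_bounded_mx M -> ess_bounded_mx (fun x => (M x)^T).
Proof. by move=> bM i j; under eq_fun do rewrite mxE; exact: bM. Qed.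

Lemma ess_bounded_mulmx p q r (M : X -> 'M[R]_(p, q)) (N : X -> 'M[R]_(q, r)) :
  ess_bounded_mx M -> ess_bounded_mx N -> ess_bounded_mx (fun x => M x *m N x).
Proof.
move=> bM bN i j; under eq_fun do rewrite mxE.
by apply: ess_bounded_sum => k; exact: ess_boundedM.
Qed.

Lemma ess_bounded_dot p (u v : X -> 'cV[R]_p) :
  ess_bounded_mx u -> ess_bounded_mx v ->
  ess_bounded (fun x => ((u x)^T *m v x) 0 0).
Proof.
by move=> bu bv; apply: ess_bounded_mulmx => //; exact: ess_bounded_trmx.
Qed.

Lemma ess_bounded_det p (M : X -> 'M[R]_p) :
  ess_bounded_mx M -> ess_bounded (fun x => \det (M x)).
Proof.
move=> bM; apply: ess_bounded_sum => s; apply: ess_boundedM.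
  exact: ess_bounded_cst.
by apply: ess_bounded_prod => i; exact: bM.
Qed.

Lemma ess_bounded_adj p (M : X -> 'M[R]_p) :
  ess_bounded_mx M -> ess_bounded_mx (fun x => \adj (M x)).
Proof.
move=> bM i j; under eq_fun do rewrite mxE.
apply: ess_boundedM; first exact: ess_bounded_cst.
by apply: ess_bounded_det => k l; under eq_fun do rewrite !mxE; exact: bM.
Qed.

Lemma ess_bounded_mx_bound p q (M : X -> 'M[R]_(p, q)) : ess_bounded_mx M ->
  exists2 C, 0 < C & ae_on (fun x => forall i j, `|M x i j| <= C).
Proof.
move=> bM.
have /choice[C MC] (ij : 'I_p * 'I_q) :
    exists C, ae_on (fun x => `|M x ij.1 ij.2| <= C) by case: (bM ij.1 ij.2).
(* The sum dominates the bound of each single entry; the added 1 makes it strictly positive. *)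
exists (1 + \sum_ij `|C ij|); first by rewrite ltr_pwDl// sumr_ge0.
apply: (ae_onS _ (ae_on_forall MC)) => x _ Mx i j.
rewrite (le_trans (Mx (i, j)))// (le_trans (ler_norm _))// (bigD1 (i, j))//=.
by rewrite addrCA lerDl addr_ge0// sumr_ge0.
Qed.

(** Nested conditionals along the enumeration of [I] pick the first index whose test succeeds, with
    0 as the default; finitely many measurable tests keep the result measurable. *)
Lemma ess_bounded_mx_select (mD : measurable D) p q (I : finType)
    (g : I -> X -> bool) (f : I -> X -> 'M[R]_(p, q)) :
  (forall i, measurable_fun D (g i)) -> (forall i, ess_bounded_mx (f i)) ->
  exists2 h, ess_bounded_mx h &
    forall x, (exists i, g i x) -> exists2 i, g i x & h x = f i x.
Proof.
move=> mg bf.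
suff [h bh hP] : exists2 h, ess_bounded_mx h & forall x,
    (exists2 i, i \in enum I & g i x) -> exists2 i, g i x & h x = f i x.
  by exists h => // x [i gi]; apply: hP; exists i; rewrite ?mem_enum.
elim: (enum I) => [|i s [h bh hP]].
  by exists (fun=> 0) => [|x [i]//]; exact: ess_bounded_mx_cst.
exists (fun x => if g i x then f i x else h x).
  move=> k l; rewrite (_ : (fun x => _) =
    (fun x => if g i x then f i x k l else h x k l)).
    by apply: ess_bounded_if; [exact: mD|exact: mg|exact: bf|exact: bh].
  by apply/funext => x; case: ifP.
move=> x [j]; case: ifPn => [gi _ _|ngi]; first by exists i.
by rewrite inE => /predU1P[->|js gj]; [rewrite (negPf ngi)|apply: hP; exists j].
Qed.

(** * Integrals of essentially bounded functions over a set of finite measure *)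

Hypotheses (mD : measurable D) (muD : (mu D < +oo)%E).

Lemma ess_bounded_integrable f : ess_bounded f -> mu.-integrable D (EFin \o f).
Proof.
move=> [mf [M fM]]; apply/integrableP; split; first exact/measurable_EFinP.
apply: (@le_lt_trans _ _ (\int[mu]_(x in D) `|M|%:E)%E); last first.
  by rewrite integral_cst// lte_mul_pinfty.
apply: ae_ge0_le_integral => //.
- by apply/measurable_EFinP; apply: measurableT_comp.
- by apply: ae_onS fM => x _ fxM; rewrite /= lee_fin (le_trans fxM)// ler_norm.
Qed.

Lemma ae_eq_Rintegral f g : ess_bounded f -> ess_bounded g ->
  ae_on (fun x => f x = g x) ->
  \int[mu]_(x in D) f x = \int[mu]_(x in D) g x.
Proof.
move=> [mf _] [mg _] fg; congr fine.
apply: ae_eq_integral => //; [exact/measurable_EFinP|exact/measurable_EFinP|].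
by apply: ae_onS fg => x _ /= ->.
Qed.

Lemma ae_le_Rintegral f g : ess_bounded f -> ess_bounded g ->
  ae_on (fun x => f x <= g x) ->
  \int[mu]_(x in D) f x <= \int[mu]_(x in D) g x.
Proof.
(* [min f g] lies below [g] everywhere and equals [f] a.e., which reduces the claim to monotonicity
   under a pointwise inequality. *)
move=> bf bg fg; have bm := ess_bounded_min bf bg.
rewrite (@ae_eq_Rintegral f (fun x => Num.min (f x) (g x)))//; last first.
  by apply: ae_onS fg => x _ /min_idPl ->.
apply: le_Rintegral => //; try exact: ess_bounded_integrable.
by move=> x _; rewrite ge_min lexx orbT.
Qed.

(** The sign conditions force the integral of [f] to be 0, hence also that of [|f|], which is [- f]
    a.e. This turns optimality, a statement on integrals, into pointwise conditions. *)
Lemma ae_eq0_Rintegral f : ess_bounded f -> ae_on (fun x => f x <= 0) ->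
  0 <= \int[mu]_(x in D) f x -> ae_on (fun x => f x = 0).
Proof.
move=> bf f0 If.
have If0 : \int[mu]_(x in D) f x = 0.
  apply/eqP; rewrite eq_le If andbT.
  rewrite (le_trans (ae_le_Rintegral bf (ess_bounded_cst 0) f0))//.
  by rewrite Rintegral_cst// mul0r.
have nf : mu.-integrable D (EFin \o f) by exact: ess_bounded_integrable.
have mf : measurable_fun D (EFin \o f) by case: bf => mf _; exact/measurable_EFinP.
have [+ _] := ae_eq_integral_abs mu mD mf.
rewrite (_ : (\int[mu]_(x in D) `|(EFin \o f) x|)%E = 0%E) => [|].
  by move=> /(_ erefl); apply: ae_onS => x Dx /= [].
transitivity (\int[mu]_(x in D) (- f x)%:E)%E.
  apply: ae_eq_integral => //.
  - exact: measurableT_comp.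
  - by case: (ess_boundedN bf) => mNf _; exact/measurable_EFinP.
  - by apply: ae_onS f0 => x _ fx0; rewrite /= ler0_norm.
under eq_integral do rewrite EFinN.
rewrite integralN.
  rewrite -[(\int[mu]_(x in D) _)%E]fineK ?integrable_fin_num//.
  by rewrite -/(Rintegral _ _ _) If0 oppe0.
exact: integrable_add_def.
Qed.

End EssBounded.

(** * Inverse Gram matrix of a set of rows *)

Section GramInverse.
Context (R : realType) (m n : nat).
Implicit Types (J : {set 'I_m}) (M : 'M[R]_(m, n)) (K : R).

(* Capping the determinant from below by [K] makes [gram_inv] a bounded function
   of [M] on bounded sets; it is the inverse Gram matrix of the rows in [J],
   padded with zeros, as soon as [K <= gram_det J M]. *)
Definition gram_inv K J M : 'M[R]_m :=
  (Num.max (gram_det J M) K)^-1 *: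
  ((rows_in J 1%:M)^T *m \adj (rows_in J M *m (rows_in J M)^T) *m
   rows_in J 1%:M).

(** Restriction to rows becomes a product with a constant 0-1 selection matrix, so that the rules
    for products apply. *)
Lemma rows_inE J M : rows_in J M = rows_in J 1%:M *m M.
Proof. by rewrite /rows_in mul_rowsub_mx mul1mx. Qed.

Lemma gram_inv_sym K J M : (gram_inv K J M)^T = gram_inv K J M.
Proof.
by rewrite /gram_inv linearZ/= !trmx_mul trmx_adj trmx_mul !trmxK mulmxA.
Qed.

Lemma gram_inv_out K J M i k : i \notin J -> gram_inv K J M i k = 0.
Proof.
move=> iJ; rewrite /gram_inv mxE -mulmxA mxE big1 ?mulr0// => l _.
rewrite 3!mxE; case: eqP => [Ji|_]; last by rewrite mul0r.
by rewrite -Ji enum_valP in iJ.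
Qed.

(** The Gram matrix times its adjugate is its determinant times the identity; as the determinant is
    at least [K], the capped factor is its exact inverse. *)
Lemma rows_in_gram_inv K J M : 0 < K -> K <= gram_det J M ->
  rows_in J M *m (M^T *m gram_inv K J M) = rows_in J 1%:M.
Proof.
move=> K0 KJ; have G0 : gram_det J M != 0 by rewrite gt_eqF// (lt_le_trans K0).
rewrite /gram_inv (max_idPl KJ) -!scalemxAr !mulmxA.
rewrite -(mulmxA _ M^T) -trmx_mul -rows_inE mul_mx_adj mul_scalar_mx.
by rewrite scalerA mulVf// scale1r.
Qed.

Lemma gram_inv_in K J M i k : 0 < K -> K <= gram_det J M -> i \in J ->
  (M *m M^T *m gram_inv K J M) i k = (i == k)%:R.
Proof.
move=> K0 KJ iJ; have := rows_in_gram_inv K0 KJ.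
rewrite [in LHS]rows_inE -!mulmxA => /matrixP/(_ (enum_rank_in iJ i) k).
by rewrite /rows_in mul_rowsub_mx mul1mx !mxE enum_rankK_in// => <-.
Qed.

Lemma cone_rows_in J M i : i \in J -> cone (rows_in J M) (row i M).
Proof.
move=> iJ; exists (delta_mx 0 (enum_rank_in iJ i)) => [k|].
  by rewrite mxE; case: (_ && _).
by rewrite -rowE; apply/rowP => j; rewrite !mxE enum_rankK_in.
Qed.

(** If [row i M] is [l] times the rows in [J], then row [i] of [M M^T Q], with [Q] the padded
    inverse, is [l] padded with zeros. Membership in the cone thus yields explicit conditions on the
    entries of [M], with no existential over [l]. *)
Lemma gram_inv_cone K J M i : 0 < K -> K <= gram_det J M ->
  cone (rows_in J M) (row i M) ->
  (forall k, 0 <= (M *m M^T *m gram_inv K J M) i k) /\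
  forall j, (M *m M^T *m gram_inv K J M *m M) i j = M i j.
Proof.
move=> K0 KJ [l l0 il].
have rowE : row i (M *m M^T *m gram_inv K J M) = l *m rows_in J 1%:M.
  by rewrite -mulmxA row_mul il -mulmxA rows_in_gram_inv.
split=> [k|j].
  have /rowP/(_ k) := rowE; rewrite !mxE => ->.
  by apply: sumr_ge0 => p _; rewrite mulr_ge0// !mxE; case: (_ == _).
have : row i (M *m M^T *m gram_inv K J M *m M) = row i M.
  by rewrite row_mul rowE -mulmxA -rows_inE -il.
by move=> /rowP/(_ j); rewrite !mxE.
Qed.

End GramInverse.

(** * Least-squares multiplier and descent direction at a fixed time *)

Section Descent.
Context (R : realType) (m n : nat).
Variables (M : 'M[R]_(m, n)) (Q : 'M[R]_m) (J : {set 'I_m}).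
Variables (c : 'cV[R]_n) (s : 'cV[R]_m).

(** With [Q] the padded inverse Gram matrix of the rows in [J], this is the least-squares solution
    of [M^T Y = c] supported on [J]. *)
Definition multiplier : 'cV[R]_m := Q *m (M *m c).

Definition residual : 'cV[R]_n := c - M^T *m multiplier.

Definition slack_step : 'cV[R]_m :=
  \col_i Num.min (- multiplier i 0) (s i 0).

Definition descent : 'cV[R]_n := M^T *m (Q *m slack_step) - residual.

Hypothesis Q_sym : Q^T = Q.
Hypothesis Q_out : forall i k, i \notin J -> Q i k = 0.
Hypothesis Q_in : forall i k, i \in J -> (M *m M^T *m Q) i k = (i == k)%:R.
Hypothesis s_ge0 : forall i, 0 <= s i 0.

Lemma gram_mul_in (v : 'cV[R]_m) i :
  i \in J -> (M *m M^T *m Q *m v) i 0 = v i 0.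
Proof.
move=> iJ; rewrite mxE (bigD1 i)//= Q_in// eqxx mul1r big1 ?addr0// => k ki.
by rewrite Q_in// eq_sym (negPf ki) mul0r.
Qed.

(** These are the normal equations: the residual is orthogonal to the rows in [J]. *)
Lemma mul_residual_in i : i \in J -> (M *m residual) i 0 = 0.
Proof.
move=> iJ; rewrite /residual /multiplier mulmxBr mxE [X in _ + X]mxE !mulmxA.
by rewrite -(mulmxA _ M c) gram_mul_in// subrr.
Qed.

Lemma mul_descent_in i : i \in J -> (M *m descent) i 0 = slack_step i 0.
Proof.
move=> iJ; rewrite /descent mulmxBr mxE [X in _ + X]mxE mul_residual_in// subr0.
by rewrite !mulmxA gram_mul_in.
Qed.

Lemma multiplier_out i : i \notin J -> multiplier i 0 = 0.
Proof. by move=> iJ; rewrite mxE big1// => k _; rewrite Q_out// mul0r. Qed.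

(** Split [c] into the residual and [M^T Y]. They are orthogonal, because [Y] vanishes off [J] and
    [M] times the residual vanishes on [J]; symmetry of [Q] moves it from the slack step onto [M c],
    which gives [Y]. *)
Lemma descent_obj :
  (c^T *m descent) 0 0 =
  \sum_i multiplier i 0 * slack_step i 0 - \sum_j residual j 0 ^+ 2.
Proof.
have residual_orth : ((M^T *m multiplier)^T *m residual) 0 0 = 0.
  rewrite trmx_mul trmxK -mulmxA mxE big1// => i _; rewrite mxE.
  have [iJ|iJ] := boolP (i \in J); first by rewrite mul_residual_in// mulr0.
  by rewrite multiplier_out// mul0r.
have cE : c = residual + M^T *m multiplier by rewrite subrK.
rewrite /descent mulmxBr mxE [X in _ + X]mxE; congr (_ - _).
  rewrite !mulmxA -(trmxK M) -!trmx_mul trmxK -Q_sym -trmx_mul mxE.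
  by apply: eq_bigr => i _; rewrite mxE.
rewrite {1}cE [X in X *m _](linearD (@trmx R n 1))/= mulmxDl mxE residual_orth addr0 mxE.
by apply: eq_bigr => j _; rewrite mxE expr2.
Qed.

Lemma multiplier_slack_step i : multiplier i 0 * slack_step i 0 <= 0.
Proof.
rewrite [X in _ * X]mxE; have [Y0|Y0] := leP 0 (multiplier i 0).
  by rewrite mulr_ge0_le0// ge_min oppr_le0 Y0.
by rewrite (mulr_le0_ge0 (ltW Y0))// le_min s_ge0 andbT oppr_ge0 ltW.
Qed.

Lemma descent_obj_le0 : (c^T *m descent) 0 0 <= 0.
Proof.
rewrite descent_obj subr_le0 (@le_trans _ _ 0)//.
  by apply: sumr_le0 => i _; exact: multiplier_slack_step.
by apply: sumr_ge0 => j _; exact: sqr_ge0.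
Qed.

(** The objective is a sum of nonpositive terms, so each product and each squared residual entry
    vanishes. *)
Lemma descent_obj_eq0 : (c^T *m descent) 0 0 = 0 ->
  [/\ M^T *m multiplier = c, forall i, multiplier i 0 <= 0 &
      forall i, multiplier i 0 * s i 0 = 0].
Proof.
rewrite descent_obj => /eqP; rewrite subr_eq0 => /eqP E.
have S1 : \sum_i multiplier i 0 * slack_step i 0 <= 0.
  by apply: sumr_le0 => i _; exact: multiplier_slack_step.
have S2 : \sum_j residual j 0 ^+ 2 = 0.
  by apply/eqP; rewrite eq_le -{1}E S1/= sumr_ge0// => j _; exact: sqr_ge0.
have Ys i : multiplier i 0 * slack_step i 0 = 0.
  apply/eqP; rewrite -oppr_eq0; apply/eqP.
  apply: (@psumr_eq0P _ _ predT (fun i => - (multiplier i 0 * slack_step i 0))) => //.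
    by move=> k _; rewrite oppr_ge0 multiplier_slack_step.
  by rewrite sumrN E S2 oppr0.
(* If [Y_i > 0], then [- Y_i < 0 <= s_i], so the minimum is [- Y_i] and the vanishing product is
   [- Y_i ^ 2], a contradiction. *)
have Y0 i : multiplier i 0 <= 0.
  rewrite leNgt; apply/negP => Yi; move: (Ys i); rewrite [X in _ * X]mxE.
  rewrite min_l; last by rewrite (le_trans _ (s_ge0 i))// oppr_le0 ltW.
  by move=> /eqP; rewrite mulf_eq0 oppr_eq0 orbb gt_eqF.
split=> // [|i].
  have r0 : residual = 0.
    apply/colP => j; rewrite [RHS]mxE; apply/eqP; rewrite -sqrf_eq0; apply/eqP.
    by apply: (psumr_eq0P _ S2) => // k _; exact: sqr_ge0.
  by apply/esym/eqP; rewrite -subr_eq0; exact/eqP.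
move: (Ys i); rewrite [X in _ * X]mxE.
have [//|_] := leP (s i 0) (- multiplier i 0).
by move=> /eqP; rewrite mulf_eq0 oppr_eq0 orbb => /eqP ->; rewrite mul0r.
Qed.

(** The alternatives reflect the two cases of [beta_A]. For [i] in [J] the step is a minimum with
    [s_i]. Otherwise row [i] is a nonnegative combination of rows in [J], on each of which [M d] is
    at most the slack 0. *)
Lemma mul_descent_le i :
  (forall k, 0 <= (M *m M^T *m Q) i k) ->
  (forall j, (M *m M^T *m Q *m M) i j = M i j) ->
  (forall k, k \in J -> s k 0 = 0) \/ i \in J ->
  (M *m descent) i 0 <= s i 0.
Proof.
move=> l0 lM [sJ|iJ]; last first.
  by rewrite mul_descent_in// mxE ge_min lexx orbT.
apply: le_trans (s_ge0 i).
have -> : (M *m descent) i 0 = (M *m M^T *m Q *m (M *m descent)) i 0.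
  by rewrite mulmxA mxE [RHS]mxE; apply: eq_bigr => j _; rewrite lM.
rewrite mxE; apply: sumr_le0 => k _.
have [kJ|kJ] := boolP (k \in J).
  by rewrite mulr_ge0_le0// mul_descent_in// mxE ge_min sJ// lexx orbT.
(* By symmetry the columns of [Q] outside [J] vanish too, so only rows in [J] contribute. *)
rewrite [X in X * _]mxE big1 ?mul0r// => p _.
have -> : Q p k = 0 by rewrite -Q_sym mxE Q_out.
by rewrite mulr0.
Qed.

End Descent.

(** * Measurable choice of the row set, and the resulting descent direction *)

Section GoodRows.
Context (R : realType) (m n : nat).

(* Unlike the index sets of [beta_A], which need not depend measurably on [t],
   this condition on [M := A t] and the slack [s := b t - A t *m z t] is
   measurable in [t] for each fixed [J]. *)
Definition good_rows (K beta : R) (J : {set 'I_m}) (M : 'M[R]_(m, n))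
    (s : 'cV[R]_m) : bool :=
  [&& K <= gram_det J M,
      [forall i, (s i 0 <= beta) ==>
        [forall k, 0 <= (M *m M^T *m gram_inv K J M) i k] &&
        [forall j, (M *m M^T *m gram_inv K J M *m M) i j == M i j]] &
      [forall i, (i \in J) ==> (s i 0 == 0)] ||
      [forall i, (s i 0 <= beta) ==> (i \in J)]].

Lemma good_rows_descent K beta J M s (c : 'cV[R]_n)
    (Q := gram_inv K J M) (d := descent M Q c s) (Y := multiplier M Q c) :
  0 < K -> (forall i, 0 <= s i 0) -> good_rows K beta J M s ->
  [/\ (c^T *m d) 0 0 <= 0,
      forall i, s i 0 <= beta -> (M *m d) i 0 <= s i 0 &
      (c^T *m d) 0 0 = 0 ->
      [/\ M^T *m Y = c, forall i, Y i 0 <= 0 & forall i, Y i 0 * s i 0 = 0]].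
Proof.
move=> K0 s0 /and3P[KJ /forallP coneJ actJ].
have Q_sym := gram_inv_sym K J M : Q^T = Q.
have Q_out i k : i \notin J -> Q i k = 0 by exact: gram_inv_out.
have Q_in i k : i \in J -> (M *m M^T *m Q) i k = (i == k)%:R.
  exact: gram_inv_in.
split.
- exact: (descent_obj_le0 _ Q_sym Q_out Q_in).
- move=> i si; have /implyP/(_ si)/andP[/forallP l0 /forallP lM] := coneJ i.
  apply: (mul_descent_le _ Q_sym Q_out Q_in s0 l0) => [j|]; first exact/eqP.
  case/orP: actJ => /forallP actJ; [left => k kJ|right].
    by have /implyP/(_ kJ)/eqP := actJ k.
  by have /implyP/(_ si) := actJ i.
- exact: (descent_obj_eq0 Q_sym Q_out Q_in).
Qed.

Context d (X : measurableType d) (mu : {measure set X -> \bar R}) (D : set X).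
Hypothesis mD : measurable D.
Variables (M : X -> 'M[R]_(m, n)) (s : X -> 'cV[R]_m).
Hypotheses (bM : ess_bounded_mx mu D M) (bs : ess_bounded_mx mu D s).

Lemma ess_bounded_gram_inv K J :
  0 < K -> ess_bounded_mx mu D (fun x => gram_inv K J (M x)).
Proof.
move=> K0.
have bJ : ess_bounded_mx mu D (fun x => rows_in J (M x)).
  by under eq_fun do rewrite rows_inE;
    exact/ess_bounded_mulmx/bM/ess_bounded_mx_cst.
have bG : ess_bounded_mx mu D (fun x => rows_in J (M x) *m (rows_in J (M x))^T).
  by apply: ess_bounded_mulmx => //; exact: ess_bounded_trmx.
apply: ess_bounded_mxZ.
  by apply: ess_bounded_inv_max => //; exact: ess_bounded_det.
apply: ess_bounded_mulmx; last exact: ess_bounded_mx_cst.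
apply: ess_bounded_mulmx; first exact: ess_bounded_mx_cst.
exact: ess_bounded_adj.
Qed.

Lemma measurable_good_rows K beta J : 0 < K ->
  measurable_fun D (fun x => good_rows K beta J (M x) (s x)).
Proof.
move=> K0; have bQ := ess_bounded_gram_inv J K0.
have bP : ess_bounded_mx mu D (fun x => M x *m (M x)^T *m gram_inv K J (M x)).
  apply: ess_bounded_mulmx => //.
  by apply: ess_bounded_mulmx => //; exact: ess_bounded_trmx.
have bPM : ess_bounded_mx mu D
    (fun x => M x *m (M x)^T *m gram_inv K J (M x) *m M x).
  exact: ess_bounded_mulmx.
have bG : ess_bounded mu D (fun x => gram_det J (M x)).
  apply: ess_bounded_det; apply: ess_bounded_mulmx;
    last apply: ess_bounded_trmx;
  by under eq_fun do rewrite rows_inE;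
    exact/ess_bounded_mulmx/bM/ess_bounded_mx_cst.
have ms i : measurable_fun D (fun x => s x i 0 <= beta).
  by apply: measurable_fun_ler; [exact: (bs i 0).1|exact: measurable_cst].
apply: measurable_and.
  by apply: measurable_fun_ler; [exact: measurable_cst|exact: bG.1].
apply: measurable_and.
  apply: measurable_forall => // i; apply: measurable_implyb => //.
  apply: measurable_and; apply: measurable_forall => // k.
    by apply: measurable_fun_ler; [exact: measurable_cst|exact: (bP i k).1].
  by apply: measurable_fun_eqr; [exact: (bPM i k).1|exact: (bM i k).1].
apply: measurable_or; apply: measurable_forall => // i;
  apply: measurable_implyb => //.
by apply: measurable_fun_eqr; [exact: (bs i 0).1|exact: measurable_cst].
Qed.

Lemma exists_descent K beta (c : X -> 'cV[R]_n) :
  0 < K -> ess_bounded_mx mu D c ->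
  ae_on mu D (fun x => forall i, 0 <= s x i 0) ->
  ae_on mu D (fun x => exists J, good_rows K beta J (M x) (s x)) ->
  exists (d : X -> 'cV[R]_n) (Y : X -> 'cV[R]_m),
  [/\ ess_bounded_mx mu D d, ess_bounded_mx mu D Y &
  ae_on mu D (fun x =>
    [/\ ((c x)^T *m d x) 0 0 <= 0,
        forall i, s x i 0 <= beta -> (M x *m d x) i 0 <= s x i 0 &
        ((c x)^T *m d x) 0 0 = 0 ->
        [/\ (M x)^T *m Y x = c x, forall i, Y x i 0 <= 0 &
            forall i, Y x i 0 * s x i 0 = 0]])].
Proof.
move=> K0 bc s0 good.
(* The matrix [Q] is selected rather than [J]: [d] and [Y] depend on [J] only through [Q], and a
   matching [J] is recovered pointwise from [QE]. *)
have [Q bQ QE] := ess_bounded_mx_select mD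
  (fun J => measurable_good_rows beta J K0)
  (fun J => ess_bounded_gram_inv J K0).
have bY : ess_bounded_mx mu D (fun x => multiplier (M x) (Q x) (c x)).
  by apply: ess_bounded_mulmx => //; exact: ess_bounded_mulmx.
have bT := ess_bounded_trmx bM.
exists (fun x => descent (M x) (Q x) (c x) (s x)).
exists (fun x => multiplier (M x) (Q x) (c x)); split=> //.
  apply: ess_bounded_mxB.
    apply: ess_bounded_mulmx => //; apply: ess_bounded_mulmx => // i j.
    under eq_fun do rewrite mxE.
    by apply: ess_bounded_min => //; exact: ess_boundedN.
  by apply: ess_bounded_mxB => //; exact: ess_bounded_mulmx.
apply: ae_onS (ae_on_and s0 good) => x _ [sx0 /QE[J goodJ ->]].
exact: good_rows_descent.
Qed.

End GoodRows.

(** * The interval [[0, T]] under completed Lebesgue measure, and its essentially bounded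
    functions *)

Section CompletedLebesgue.
Context (R : realType) (T : R).
Hypothesis T_gt0 : 0 < T.
Local Notation D := [set` `[0, T]].

Lemma measurable_itv0T : ((@wlength R idfun)^*%mu).-cara.-measurable D.
Proof.
apply: (@sub_caratheodory _ (ocitv_type R)).
exact: (@measurable_itv R `[0, T]).
Qed.

Lemma leb_itv0T : leb D = T%:E.
Proof.
transitivity (lebesgue_measure (D : set R)); first by [].
by rewrite lebesgue_measure_itv/= lte_fin T_gt0 -EFinD subr0.
Qed.

Lemma LinftyE (f : R -> R) : Linfty T f <-> ess_bounded leb D f.
Proof.
have mD := measurable_itv0T.
(* The norm of exponent [+oo] is defined by cases on whether the whole space has positive
   measure. *)
have lebT : (0 < leb [set: R])%E.
  apply: (@lt_le_trans _ _ (leb D)); first by rewrite leb_itv0T lte_fin.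
  by apply: le_measure; rewrite ?inE.
rewrite /Linfty /ess_bounded inE; split.
  move=> /andP[]; rewrite !inE /= /finite_norm unlock lebT => mf fM; split.
    exact/(measurable_restrictT _ mD).
  have [M HM] := ess_supr_bounded fM.
  exists M; rewrite /ae_on; apply: filterS HM => x /= + Dx.
  by rewrite patchE mem_set.
move=> [mf [M fM]]; apply/andP; rewrite !inE /= /finite_norm unlock lebT; split.
  exact/(measurable_restrictT _ mD).
(* [M] bounds the function on the interval, and 0 bounds its extension outside. *)
apply: (@le_lt_trans _ _ (Num.max M 0)%:E); last exact: ltry.
apply/ess_supP; move: fM; rewrite /ae_on; apply: filterS => x /= Hx.
rewrite lee_fin patchE; case: ifPn => [/set_mem/Hx xM|_].
  by rewrite le_max xM.
by rewrite normr0 le_max lexx orbT.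
Qed.

Lemma Linfty_mxE p q (M : R -> 'M[R]_(p, q)) :
  Linfty_mx T M <-> ess_bounded_mx leb D M.
Proof. by split=> bM i j; exact/LinftyE. Qed.

End CompletedLebesgue.

(** * Weak duality, and a dual solution with no gap *)

Section Duality.
Context (R : realType) (m n : nat) (T : R).
Variables (A : R -> 'M[R]_(m, n)) (b : R -> 'cV[R]_m) (c : R -> 'cV[R]_n).
Hypotheses (T_gt0 : 0 < T) (A_Linfty : Linfty_mx T A).
Hypotheses (b_Linfty : Linfty_mx T b) (c_Linfty : Linfty_mx T c).
Local Notation D := [set` `[0, T]].
Local Notation bounded_mx := (ess_bounded_mx leb D).

Let mD := measurable_itv0T T.

Let lebD : (leb D < +oo)%E.
Proof. by rewrite leb_itv0T// ltry. Qed.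

Let bA : bounded_mx A. Proof. exact/Linfty_mxE. Qed.
Let bb : bounded_mx b. Proof. exact/Linfty_mxE. Qed.
Let bc : bounded_mx c. Proof. exact/Linfty_mxE. Qed.

(** Pointwise, [w <= 0] and [A z <= b] give [b^T w <= (A z)^T w], and the right side is [c^T z]
    because [A^T w = c]. *)
Lemma weak_duality (z : R -> 'cV[R]_n) (w : R -> 'cV[R]_m) :
  Omega T A b z -> Theta T A c w -> G T b w <= F T c z.
Proof.
move=> [/(Linfty_mxE T_gt0) bz Az] [/(Linfty_mxE T_gt0) bw Aw].
apply: (ae_le_Rintegral mD lebD); [exact: ess_bounded_dot..|].
apply: ae_onS (ae_on_and Az Aw) => t _ [Azb [<- w0]].
rewrite trmx_mul trmxK -mulmxA mxE [leRHS]mxE; apply: ler_sum => i _.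
by have := Azb i; rewrite !mxE mulrC => Azi; exact: ler_wnM2l.
Qed.

(** In the first case [J] is [I_sharp t], whose slacks vanish; in the second it is [I_beta] itself,
    whose rows trivially lie in their own cone. Feasibility puts every row of slack at most [beta]
    in [I_beta]. *)
Lemma beta_A_good_rows (z : R -> 'cV[R]_n) beta :
  Omega T A b z -> beta_A T A b z beta ->
  exists2 K, 0 < K & ae_on leb D (fun t => exists J,
    good_rows K beta J (A t) (b t - A t *m z t)).
Proof.
move=> [_ Azb].
have slackE t i : (b t - A t *m z t) i 0 = b t i 0 - (A t *m z t) i 0.
  by rewrite [LHS]mxE [X in _ + X]mxE.
have in_I_beta t i : (forall i, (A t *m z t) i 0 <= b t i 0) ->
    (b t - A t *m z t) i 0 <= beta -> i \in I_beta A b z beta t.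
  by move=> Az; rewrite slackE inE subr_le0 Az andbT lerNl opprB.
case=> [[Is [_ [K K0 HK]] Is0]|[K K0 HK]]; exists K => //.
  apply: ae_onS (ae_on_and (ae_on_and HK Is0) Azb) => t _.
  move=> [[[coneE KJ] IsI0] Az].
  exists (Is t); rewrite /good_rows KJ/=; apply/andP; split.
    apply/forallP => i; apply/implyP => /(in_I_beta _ _ Az) iI.
    have : cone (rows_in (Is t) (A t)) (row i (A t)).
      by rewrite coneE; exact: cone_rows_in.
    move=> /(gram_inv_cone K0 KJ)[l0 lA].
    by apply/andP; split; apply/forallP => k; rewrite ?lA// l0.
  apply/orP; left; apply/forallP => i; apply/implyP => /(fintype.subsetP IsI0).
  by rewrite inE slackE subr_eq0 eq_sym subr_eq0.
apply: ae_onS (ae_on_and HK Azb) => t _ [KJ Az].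
exists (I_beta A b z beta t); rewrite /good_rows KJ/=; apply/andP; split.
  apply/forallP => i; apply/implyP => /(in_I_beta _ _ Az).
  move=> /(cone_rows_in (A t))/(gram_inv_cone K0 KJ)[l0 lA].
  by apply/andP; split; apply/forallP => k; rewrite ?lA// l0.
apply/orP; right; apply/forallP => i; apply/implyP.
exact: in_I_beta.
Qed.

Lemma exists_multiplier (z : R -> 'cV[R]_n) beta :
  0 < beta -> beta_A T A b z beta -> CLP_optimal T A b c z ->
  exists2 w, Theta T A c w & G T b w = F T c z.
Proof.
move=> beta0 zA [zO zopt].
have [K K0 good] := beta_A_good_rows zO zA.
have [/(Linfty_mxE T_gt0) bz Azb] := zO.
have bs : bounded_mx (fun t => b t - A t *m z t).
  exact: ess_bounded_mxB bb (ess_bounded_mulmx bA bz).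
have s0 : ae_on leb D (fun t => forall i, 0 <= (b t - A t *m z t) i 0).
  apply: ae_onS Azb => t _ Az i.
  by rewrite mxE [X in _ + X]mxE subr_ge0.
have [d [Y [bd bY dY]]] := exists_descent mD bA bs K0 bc s0 good.
have [C C0 AdC] := ess_bounded_mx_bound (ess_bounded_mulmx bA bd).
(* The bound 1 serves rows of slack at most [beta], where [(A d)_i <= s_i]; the bound [beta / C]
   serves the others, where [eps * (A d)_i <= eps * C <= beta < s_i]. *)
pose eps := Num.min 1 (beta / C).
have eps0 : 0 < eps by rewrite lt_min ltr01 divr_gt0.
have bzd : bounded_mx (fun t => z t + eps *: d t).
  exact: ess_bounded_mxD bz (ess_bounded_mxZ (ess_bounded_cst _ _ eps) bd).
have zdO : Omega T A b (fun t => z t + eps *: d t).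
  split; first exact/Linfty_mxE.
  apply: ae_onS (ae_on_and (ae_on_and s0 dY) AdC) => t _.
  move=> [[st0 [_ Ads _]] AdCt] i.
  have : eps * (A t *m d t) i 0 <= (b t - A t *m z t) i 0.
    have [si|si] := leP ((b t - A t *m z t) i 0) beta.
      have [Ad0|Ad0] := leP ((A t *m d t) i 0) 0.
        by rewrite (le_trans _ (st0 i))// pmulr_rle0.
      apply: le_trans (Ads i si); apply: ler_piMl; first exact: ltW.
      by rewrite /eps ge_min lexx.
    apply: le_trans (ltW si); apply: (@le_trans _ _ (eps * C)).
      by rewrite ler_pM2l// (le_trans (ler_norm _)).
    by rewrite -ler_pdivlMr// /eps ge_min lexx orbT.
  have -> : (b t - A t *m z t) i 0 = b t i 0 - (A t *m z t) i 0.
    by rewrite mxE [X in _ + X]mxE.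
  rewrite lerBrDl; apply: le_trans.
  by rewrite mulmxDr -scalemxAr mxE [X in _ + X]mxE.
have bcd := ess_bounded_dot bc bd.
have bcz := ess_bounded_dot bc bz.
have becd := ess_boundedM (ess_bounded_cst leb D eps) bcd.
(* Comparing [z] with [z + eps d] makes the integral of [c^T d] nonnegative, while the integrand is
   nonpositive a.e. *)
have cd0 : ae_on leb D (fun t => ((c t)^T *m d t) 0 0 = 0).
  apply: (ae_eq0_Rintegral mD lebD) => //.
    by apply: ae_onS dY => t _ [].
  have := zopt _ zdO.
  rewrite /F (_ : (\int[leb]_(t in D) ((c t)^T *m (z t + eps *: d t)) 0 0) =
    \int[leb]_(t in D) ((c t)^T *m z t) 0 0 +
    eps * \int[leb]_(t in D) ((c t)^T *m d t) 0 0).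
    by rewrite lerDl pmulr_rge0.
  rewrite -RintegralZl//; last exact: ess_bounded_integrable.
  rewrite -RintegralD//.
  - apply: eq_Rintegral => t _; rewrite mulmxDr -scalemxAr mxE.
    by rewrite [X in _ + X]mxE.
  - exact: ess_bounded_integrable.
  - exact: ess_bounded_integrable.
exists Y.
  split; first exact/Linfty_mxE.
  by apply: ae_onS (ae_on_and dY cd0) => t _ [[_ _ kkt] /kkt[]].
(* Complementary slackness [Y_i s_i = 0] equates [b^T Y] with [(A z)^T Y = c^T z]. *)
apply: (ae_eq_Rintegral mD); [exact: ess_bounded_dot..|].
apply: ae_onS (ae_on_and dY cd0) => t _ [[_ _ kkt] /kkt[<- _ Ys]].
rewrite trmx_mul trmxK -mulmxA mxE [RHS]mxE; apply: eq_bigr => i _.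
have /eqP := Ys i; rewrite [X in _ * X]mxE [X in _ * (_ + X)]mxE mulrBr subr_eq0.
by rewrite [_^T 0 i]mxE [_^T 0 i]mxE mulrC => /eqP.
Qed.

End Duality.

Theorem theorem4p8 (R : realType) (m n : nat) (T : R)
    (A : R -> 'M[R]_(m, n)) (b : R -> 'cV[R]_m) (c : R -> 'cV[R]_n)
    (T_gt0 : 0 < T)
    (A_Linfty : Linfty_mx T A) (b_Linfty : Linfty_mx T b)
    (c_Linfty : Linfty_mx T c)
    (z : R -> 'cV[R]_n) (w : R -> 'cV[R]_m)
    (z_feasible : Omega T A b z) (w_feasible : Theta T A c w)
    (beta : R) (beta_gt0 : 0 < beta) (z_beta_A : beta_A T A b z beta) :
  F T c z = G T b w <-> CLP_optimal T A b c z /\ CDP_optimal T A b c w.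
Proof.
have weak := weak_duality (A := A) T_gt0 b_Linfty c_Linfty.
split=> [FG|[zopt [_ wopt]]].
  (* When the values agree, each one is the weak-duality bound for the other problem. *)
  by split; split=> // y yO; [rewrite FG|rewrite -FG]; exact: weak.
(* Optimality of [w] against the gap-free [w'] gives [F z = G w' <= G w]; weak duality gives the
   converse inequality. *)
have [w' w'T w'F] :=
  exists_multiplier T_gt0 A_Linfty b_Linfty c_Linfty beta_gt0 z_beta_A zopt.
by apply/eqP; rewrite eq_le weak// andbT -w'F wopt.
Qed.
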